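(* Let $X$ be a compact Hausdorff space, $\mathcal C = C(X)$ the algebra of continuous real-valued functions on $X$ with the supremum norm, $\alpha\colon X\to X$ a continuous map, $\delta\colon \mathcal C\to\mathcal C$ the endomorphism $\delta f = f\circ\alpha$, and $A\colon \mathcal C\to\mathcal C$ a transfer operator for $(\mathcal C,\delta)$. For $\varphi\in\mathcal C$ let $A_\varphi f = A(e^\varphi f)$ and let $\lambda(\varphi)=\lim_{n\to\infty}\frac1n\ln\|A_\varphi^n\mathbf 1\|$ be the spectral potential. Then for every $\mu\in M_\delta(\mathcal C)$, \[ \tau(\mu)=\inf_{\varphi\in\mathcal C}\bigl(\lambda(\varphi)-\mu[\varphi]\bigr), \] where $\tau$ is the $t$-entropy.
   Context: A transfer operator for $(\mathcal C,\delta)$ is a linear operator $A\colon\mathcal C\to\mathcal C$ that is positive (maps nonnegative functions to nonnegative functions) and satisfies the homological identity $A((\delta f)g)=f\,Ag$ for all $f,g\in\mathcal C$. $\mathbf 1$ denotes the constant function $1$. $M(\mathcal C)$ is the set of positive linear functionals $m$ on $\mathcal C$ with $m[\mathbf 1]=1$ (identified with regular Borel probability measures on $X$), and $M_\delta(\mathcal C)=\{\mu\in M(\mathcal C): \mu[\delta f]=\mu[f]\ \forall f\in\mathcal C\}$. A partition of unity is a finite set $D=\{g_1,\dots,g_k\}$ of nonnegative elements of $\mathcal C$ with $g_1+\dots+g_k=\mathbf 1$. For $\mu\in M_\delta(\mathcal C)$, $n\in\mathbb N$ and a partition of unity $D$ put \[ \tau_n(\mu,D)=\sup_{m\in M(\mathcal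 C)}\sum_{g\in D}\mu[g]\ln\frac{m[A^ng]}{\mu[g]},\qquad \tau_n(\mu)=\inf_D\tau_n(\mu,D),\qquad \tau(\mu)=\inf_{n\in\mathbb N}\frac{\tau_n(\mu)}{n}, \] the infimum over $D$ ranging over all partitions of unity; a summand with $\mu[g]=0$ is set to $0$ regardless of $m[A^ng]$, $\ln 0=-\infty$, and if some $g\in D$ has $A^ng=0$ and $\mu[g]>0$ then $\tau(\mu)=-\infty$. $\tau(\mu)$ is called the $t$-entropy. *)

(* Defs.v *)
From HB Require Import structures.
From mathcomp Require Import all_boot all_order all_algebra.
From mathcomp Require Import all_classical all_reals all_analysis.
Set Implicit Arguments. Unset Strict Implicit. Unset Printing Implicit Defensive.
Import Order.TTheory GRing.Theory Num.Theory.
Import numFieldNormedType.Exports.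
Local Open Scope classical_set_scope.
Local Open Scope ring_scope.

Section TEntropy.
Variables (R : realType) (X : topologicalType).

Definition cfun (f : X -> R) : Prop := continuous f.

Definition one : X -> R := fun _ => 1.

Definition supnorm (f : X -> R) : R := sup (range (fun x => `|f x|)).

(* extended logarithm: ln 0 = -oo (only used on nonnegative arguments) *)
Definition lnE (x : R) : \bar R := if x == 0 then -oo%E else (ln x)%:E.

Definition transfer_operator (alpha : X -> X) (A : (X -> R) -> (X -> R)) : Prop :=
  [/\ (forall f, cfun f -> cfun (A f)),
      (forall (a : R) f g, cfun f -> cfun g ->
         A (fun x => a * f x + g x) = (fun x => a * A f x + A g x)),
      (forall f, cfun f -> (forall x, 0 <= f x) -> forall x, 0 <= A f x) &
      (forall f g, cfun f -> cfun g ->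
         A (fun x => f (alpha x) * g x) = (fun x => f x * A g x))].

Definition state (m : (X -> R) -> R) : Prop :=
  [/\ (forall (a : R) f g, cfun f -> cfun g ->
         m (fun x => a * f x + g x) = a * m f + m g),
      (forall f, cfun f -> (forall x, 0 <= f x) -> 0 <= m f) &
      m one = 1].

Definition inv_state (alpha : X -> X) (mu : (X -> R) -> R) : Prop :=
  state mu /\ forall f, cfun f -> mu (fun x => f (alpha x)) = mu f.

Definition partition_of_unity (k : nat) (g : 'I_k -> X -> R) : Prop :=
  (forall i, cfun (g i)) /\ (forall i x, 0 <= g i x) /\
  (forall x, \sum_(i < k) g i x = 1).

Definition tsummand (A : (X -> R) -> (X -> R)) (n : nat)
    (mu m : (X -> R) -> R) (g : X -> R) : \bar R :=
  if mu g == 0 then 0%E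
  else ((mu g)%:E * lnE (m (iter n A g) / mu g))%E.

Definition tau_nD (A : (X -> R) -> (X -> R)) (mu : (X -> R) -> R) (n : nat)
    (k : nat) (g : 'I_k -> X -> R) : \bar R :=
  ereal_sup [set (\sum_(i < k) tsummand A n mu m (g i))%E | m in state].

Definition tau_n (A : (X -> R) -> (X -> R)) (mu : (X -> R) -> R) (n : nat) : \bar R :=
  ereal_inf [set t | exists k (g : 'I_k -> X -> R),
                       partition_of_unity g /\ t = tau_nD A mu n g].

Definition t_entropy (A : (X -> R) -> (X -> R)) (mu : (X -> R) -> R) : \bar R :=
  ereal_inf [set (tau_n A mu n * (n%:R^-1)%:E)%E | n in [set n : nat | (0 < n)%N]].

Definition Aphi (A : (X -> R) -> (X -> R)) (phi : X -> R) (f : X -> R) : X -> R :=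
  A (fun x => expR (phi x) * f x).

Definition spectral_potential (A : (X -> R) -> (X -> R)) (phi : X -> R) : \bar R :=
  lim ((fun n : nat => ((n%:R^-1)%:E * lnE (supnorm (iter n (Aphi A phi) one)))%E) @ \oo).

End TEntropy.

(* Main.v *)
Require Import Defs.
From HB Require Import structures.
From mathcomp Require Import all_boot all_order all_algebra.
From mathcomp Require Import all_classical all_reals all_analysis.
From mathcomp Require Import ring lra.
Import Order.TTheory GRing.Theory Num.Theory.
Import numFieldNormedType.Exports.
Local Open Scope classical_set_scope.
Local Open Scope ring_scope.

(** Write [S_n phi] for the Birkhoff sum, so that [A_phi^n f = A^n (e^(S_n phi) f)].

    [tau <= lambda - mu]: if [A_phi^n 1 <= theta], take a partition of unity [g_i]
    so fine that [S_n phi] is almost a constant [s_i] on the support of [g_i], and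
    apply [ln x <= x / a - 1 + ln a] to each summand with [a = theta e^(- s_i)].

    [inf (lambda - mu) <= tau]: given [n] and [D = {g_i}], put [p_i = mu g_i] and let
    [m0] nearly maximize [m |-> \sum p_i ln (m (A^n g_i))] over the states. The
    first-order condition in the direction of the point evaluations says that
    [h = \sum p_i / m0 (A^n g_i) * g_i] satisfies [A^n h <= 1] up to a small error,
    while concavity of [ln] bounds [mu (ln h)] below by minus the [D]-entropy. With
    [phi = ln h], the potential [phi / n] has [lambda (phi / n) <= 0] up to the
    same error, because [S_(Nn) (phi / n)] is an average of [n] Birkhoff sums of [phi]
    along [alpha^n]. *)

(** * Closure properties and boundedness of continuous functions *)

Section Continuity.
Context {R : realType} {X : topologicalType}.
Implicit Types f g : X -> R.

Lemma cfun_cst (c : R) : cfun (fun _ : X => c).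
Proof. exact: cst_continuous. Qed.

Lemma cfunD {f g} : cfun f -> cfun g -> cfun (fun x => f x + g x).
Proof. by move=> cf cg x; apply: continuousD; [exact: cf|exact: cg]. Qed.

Lemma cfunM {f g} : cfun f -> cfun g -> cfun (fun x => f x * g x).
Proof. by move=> cf cg x; apply: continuousM; [exact: cf|exact: cg]. Qed.

Lemma cfunN {f} : cfun f -> cfun (fun x => - f x).
Proof. by move=> cf x; apply: continuousN; exact: cf. Qed.

Lemma cfunB {f g} : cfun f -> cfun g -> cfun (fun x => f x - g x).
Proof. by move=> cf cg; apply: cfunD => //; exact: cfunN. Qed.

Lemma cfunZ (c : R) {f} : cfun f -> cfun (fun x => c * f x).
Proof. by apply: cfunM; exact: cfun_cst. Qed.

Lemma cfun_max {f g} : cfun f -> cfun g -> cfun (fun x => Num.max (f x) (g x)).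
Proof. by move=> cf cg x; apply: continuous_max; [exact: cf|exact: cg]. Qed.

Lemma cfun_min {f g} : cfun f -> cfun g -> cfun (fun x => Num.min (f x) (g x)).
Proof. by move=> cf cg x; apply: continuous_min; [exact: cf|exact: cg]. Qed.

Lemma cfun_sum {k} {f : 'I_k -> X -> R} :
  (forall i, cfun (f i)) -> cfun (fun x => \sum_(i < k) f i x).
Proof.
elim: k f => [|k IH] f cf.
  have -> : (fun x => \sum_(i < 0) f i x) = fun=> 0.
    by apply/funext => x; rewrite big_ord0.
  exact: cfun_cst.
have -> : (fun x => \sum_(i < k.+1) f i x) =
          (fun x => \sum_(i < k) f (widen_ord (leqnSn k) i) x + f ord_max x).
  by apply/funext => x; rewrite big_ord_recr.
by apply: cfunD => //; apply: IH.
Qed.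

Lemma cfun_exp {f} : cfun f -> cfun (fun x => expR (f x)).
Proof.
by move=> cf x; apply: continuous_comp; [exact: cf|exact: continuous_expR].
Qed.

Lemma cfun_ln {f} : (forall x, 0 < f x) -> cfun f -> cfun (fun x => ln (f x)).
Proof.
by move=> f0 cf x; apply: continuous_comp; [exact: cf|exact: continuous_ln].
Qed.

Lemma cfun_comp {alpha : X -> X} {f} :
  continuous alpha -> cfun f -> cfun (fun x => f (alpha x)).
Proof. by move=> ca cf x; apply: continuous_comp; [exact: ca|exact: cf]. Qed.

Lemma cfun_bounded {f} : compact [set: X] -> cfun f ->
  exists2 B, 0 < B & forall x, `|f x| <= B.
Proof.
move=> cX cf.
have := compact_bounded (continuous_compact (continuous_subspaceT cf) cX).
move=> [M [_ HM]]; exists (`|M| + 1) => [|x]; first by rewrite ltr_wpDl.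
apply: (HM (`|M| + 1)); last by exists x.
by rewrite (le_lt_trans (ler_norm M))// ltrDl.
Qed.

End Continuity.

(** * Positive linear functionals, states and positive operators *)

Section PositiveFunctionals.
Context {R : realType} {X : topologicalType}.
Implicit Types (f g : X -> R) (m : (X -> R) -> R).

(** Normalization is dropped so that point evaluations of iterated operators also qualify. *)
Definition plf m :=
  (forall (a : R) f g, cfun f -> cfun g ->
     m (fun x => a * f x + g x) = a * m f + m g) /\
  (forall f, cfun f -> (forall x, 0 <= f x) -> 0 <= m f).

Lemma state_plf {m} : state m -> plf m.
Proof. by case. Qed.

Lemma plf_eval (x : X) : plf (fun f => f x).
Proof. by split=> // f _; apply. Qed.

Lemma plf0 {m} : plf m -> m (fun=> 0) = 0.
Proof.
case=> L _; have := L 1 (fun=> 0) (fun=> 0) (cfun_cst _) (cfun_cst _).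
have -> : (fun _ : X => 1 * 0 + 0) = (fun=> 0 : R) by apply/funext => x; lra.
lra.
Qed.

Lemma plfZ {m} (a : R) {f} : plf m -> cfun f -> m (fun x => a * f x) = a * m f.
Proof.
move=> pm cf; have := pm.1 a f (fun=> 0) cf (cfun_cst _).
have -> : (fun x => a * f x + 0) = (fun x => a * f x).
  by apply/funext => x; rewrite addr0.
by rewrite plf0// addr0.
Qed.

Lemma plfD {m f g} : plf m -> cfun f -> cfun g ->
  m (fun x => f x + g x) = m f + m g.
Proof.
move=> pm cf cg; have := pm.1 1 f g cf cg; rewrite mul1r => <-.
by congr m; apply/funext => x; rewrite mul1r.
Qed.

Lemma plf_le {m f g} : plf m -> cfun f -> cfun g ->
  (forall x, f x <= g x) -> m f <= m g.
Proof.
move=> pm cf cg fg.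
have : 0 <= m (fun x => g x - f x).
  by apply: pm.2 => [|x]; [exact: cfunB|rewrite subr_ge0].
have -> : (fun x => g x - f x) = (fun x => -1 * f x + g x).
  by apply/funext => x; lra.
rewrite (pm.1 _ _ _ cf cg); lra.
Qed.

Lemma plf_sum {m k} {f : 'I_k -> X -> R} : plf m -> (forall i, cfun (f i)) ->
  m (fun x => \sum_(i < k) f i x) = \sum_(i < k) m (f i).
Proof.
move=> pm; elim: k f => [|k IH] f cf.
  rewrite big_ord0 -[RHS](plf0 pm).
  by congr m; apply/funext => x; rewrite big_ord0.
rewrite big_ord_recr/= -IH// -plfD//; last exact: cfun_sum.
by congr m; apply/funext => x; rewrite big_ord_recr.
Qed.

Lemma plf_cst {m} (c : R) : plf m -> m (fun=> c) = c * m (@Defs.one R X).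
Proof.
move=> pm; rewrite -plfZ//; last exact: cfun_cst.
by congr m; apply/funext => x; rewrite /Defs.one mulr1.
Qed.

Lemma state_cst {m} (c : R) : state m -> m (fun=> c) = c.
Proof.
move=> sm; rewrite (plf_cst c (state_plf sm)).
by case: sm => _ _ ->; rewrite mulr1.
Qed.

Lemma state_eval (x : X) : state (fun f : X -> R => f x).
Proof. by split=> // f _; apply. Qed.

(** On an empty space the constants 0 and 1 are the same function, to which [m] would give both
    values 0 and 1. *)
Lemma state_inhab {m} : state m -> inhabited X.
Proof.
move=> sm; apply: contrapT => nX; have := state_cst 0 sm.
have -> : (fun=> 0) = @Defs.one R X.
  by apply/funext => x; exfalso; apply: nX; exists.
case: sm => _ _ ->; lra.
Qed.

Lemma state_conv {m1 m2} {t : R} : 0 <= t -> t <= 1 -> state m1 -> state m2 ->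
  state (fun f => (1 - t) * m1 f + t * m2 f).
Proof.
move=> t0 t1 [L1 P1 N1] [L2 P2 N2]; split => [a f g cf cg|f cf f0|].
- rewrite L1// L2//; ring.
- by rewrite addr_ge0// mulr_ge0// ?subr_ge0//; [exact: P1|exact: P2].
- rewrite N1 N2; ring.
Qed.

(** Linearity and positivity are required pointwise, so that every fact about functionals applies to
    [P] followed by evaluation at a point. *)
Definition posop (P : (X -> R) -> X -> R) :=
  (forall f, cfun f -> cfun (P f)) /\ forall x, plf (fun f => P f x).

Lemma plf_comp {m P} : plf m -> posop P -> plf (fun f => m (P f)).
Proof.
move=> pm [cP lP]; split=> [a f g cf cg|f cf f0].
  rewrite -(pm.1 _ _ _ (cP _ cf) (cP _ cg)); congr m; apply/funext => x.
  exact: (lP x).1.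
by apply: pm.2; [exact: cP|move=> x; exact: (lP x).2].
Qed.

Lemma posop_comp {P Q} : posop P -> posop Q -> posop (fun f => P (Q f)).
Proof.
move=> [cP lP] pQ; split=> [f cf|x]; first by apply/cP/pQ.1.
exact: plf_comp (lP x) pQ.
Qed.

Lemma posop_iter {P} n : posop P -> posop (iter n P).
Proof.
move=> pP; elim: n => [|n IH].
  by split=> // x; exact: plf_eval.
exact: (posop_comp pP IH).
Qed.

Lemma posop_Aphi {P phi} : cfun phi -> posop P -> posop (Aphi P phi).
Proof.
move=> cphi pP; apply: (posop_comp (Q := fun f x => expR (phi x) * f x) pP).
split=> [f cf|x]; first by apply: cfunM => //; exact: cfun_exp.
split=> [a f g cf cg|f cf f0]; first ring.
by rewrite mulr_ge0// expR_ge0.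
Qed.

Lemma posop_iter_le {P} {c : R} n : posop P -> 0 <= c ->
  (forall x, P (@Defs.one R X) x <= c) ->
  forall x, iter n P (@Defs.one R X) x <= c ^+ n.
Proof.
move=> pP c0 P1; elim: n => [|n IH] x; first by rewrite expr0.
have cI := (posop_iter n pP).1 _ (cfun_cst 1).
rewrite iterS (le_trans (plf_le (pP.2 x) cI (cfun_cst (c ^+ n)) IH))//.
rewrite (plf_cst _ (pP.2 x)) exprSr ler_wpM2l// exprn_ge0//.
Qed.

End PositiveFunctionals.

(** * Extended-real inequalities and the extended logarithm *)

Section ExtendedReals.
Context {R : realType}.

(** When [x] is an infimum, a real [r] above it is also above some member of the family, so the goal
    becomes a claim about one member and a real bound. *)
Lemma lee_above {x y : \bar R} :
  (forall r : R, (x < r%:E)%E -> (y <= r%:E)%E) -> (y <= x)%E.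
Proof.
case: x => [x||] H; last 2 first.
- by rewrite leey.
- by rewrite (@eq_ninfty R y)// => r; apply: H; rewrite ltNyr.
- apply/lee_addgt0Pr => e e0; rewrite -EFinD; apply: H.
  by rewrite lte_fin ltrDl.
Qed.

Lemma lnE_le (x t : R) : 0 <= x -> (lnE x <= t%:E)%E = (x <= expR t).
Proof.
rewrite le_eqVlt /lnE => /predU1P[<-|x0]; first by rewrite eqxx leNye expR_ge0.
by rewrite gt_eqF// lee_fin -[t in LHS]expRK ler_ln ?posrE ?expR_gt0.
Qed.

End ExtendedReals.

(** * Growth rates of iterated positive operators *)

Section Growth.
Context {R : realType} {X : topologicalType}.
Hypotheses (cX : compact [set: X]) (x0 : X).
Implicit Types (f : X -> R) (P : (X -> R) -> X -> R).

Lemma supnorm_le {f c} : (forall x, `|f x| <= c) -> supnorm f <= c.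
Proof.
move=> fc; apply: ge_sup; first by exists `|f x0|, x0.
by move=> _ [x _ <-].
Qed.

Lemma le_supnorm {f} x : cfun f -> `|f x| <= supnorm f.
Proof.
move=> /(cfun_bounded cX)[B _ fB]; apply: ub_le_sup; last by exists x.
by exists B => _ [y _ <-].
Qed.

Definition growth P (n : nat) : \bar R :=
  ((n%:R^-1)%:E * lnE (supnorm (iter n P (@Defs.one R X))))%E.

Lemma growth_le {P n} t : posop P -> (0 < n)%N ->
  (growth P n <= t%:E)%E <->
  forall x, iter n P (@Defs.one R X) x <= expR (n%:R * t).
Proof.
move=> pP n0; have pI := posop_iter n pP.
have cI := pI.1 _ (cfun_cst 1).
have I0 x : 0 <= iter n P (@Defs.one R X) x.
  by apply: (pI.2 x).2 => [|y]; [exact: cfun_cst|exact: ler01].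
rewrite /growth lee_pdivrMl ?ltr0n// -EFinM lnE_le; last first.
  exact: le_trans (normr_ge0 _) (le_supnorm x0 cI).
split=> [H x|H].
  exact: le_trans (le_trans (ler_norm _) (le_supnorm x cI)) H.
by apply: supnorm_le => x; rewrite ger0_norm.
Qed.

(* Fekete's subadditivity argument, phrased multiplicatively. *)
Lemma growth_bound {P n} {t : R} : posop P -> (0 < n)%N ->
  (forall x, iter n P (@Defs.one R X) x <= expR (n%:R * t)) ->
  exists2 K, 0 < K & forall N x,
    iter N P (@Defs.one R X) x <= K * expR (N%:R * t).
Proof.
move=> pP n0 Pn.
have [C C0 PC] := cfun_bounded cX (pP.1 _ (cfun_cst 1)).
have D1 : 1 <= 1 + C by rewrite lerDl ltW.
have PD x : P (@Defs.one R X) x <= 1 + C.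
  by rewrite (le_trans (ler_norm _))// (le_trans (PC x))// lerDr.
have D0 := le_trans ler01 D1.
(* With [N = q * n + r], the first factor bounds the [r] leftover iterations, using [1 + C >= 1] to
   pass from power [r] to power [n]; the second absorbs the difference between [q * n * t] and
   [N * t]. *)
exists ((1 + C) ^+ n * expR (n%:R * `|t|)).
  by rewrite mulr_gt0 ?expR_gt0// exprn_gt0// (lt_le_trans ltr01).
move=> N x; rewrite {1}(divn_eq N n) iterD iterM.
set r := (N %% n)%N; set q := (N %/ n)%N.
have rn : (r <= n)%N by rewrite ltnW// ltn_pmod.
have pn := posop_iter n pP; have pq := posop_iter q pn.
have cr := (posop_iter r pP).1 _ (cfun_cst 1).
have Ir y : iter r P (@Defs.one R X) y <= (1 + C) ^+ n.
  rewrite (le_trans (posop_iter_le r pP D0 PD y))//.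
  exact: ler_weXn2l.
rewrite (le_trans (plf_le (pq.2 x) cr (cfun_cst _) Ir))//.
rewrite (plf_cst _ (pq.2 x)) -mulrA ler_wpM2l ?exprn_ge0//.
rewrite (le_trans (posop_iter_le q pn (expR_ge0 _) Pn x))//.
rewrite -expRM_natl -expRD ler_expR.
rewrite {1}(divn_eq N n) -/q -/r natrD natrM mulrDl.
have : - t * r%:R <= n%:R * `|t|.
  rewrite mulrC (le_trans (_ : _ <= r%:R * `|t|))//.
    by rewrite ler_wpM2l// -normrN ler_norm.
  by rewrite ler_wpM2r// ler_nat.
lra.
Qed.

(** If [t] bounds the growth at one positive time, [growth_bound] gives [growth P k <= ln K / k + t]
    at every positive time, so the upper limit is at most the infimum. *)
Lemma growth_lim {P} : posop P ->
  lim (growth P @ \oo) = ereal_inf [set growth P n | n in [set n | (0 < n)%N]].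
Proof.
move=> pP; apply/cvg_lim => //; rewrite -cvg_shiftS.
apply: limn_esup_le_cvg; last first.
  by move=> n; apply: ereal_inf_lbound; exists n.+1.
apply: lee_above => t /ereal_inf_ltP[_ [n n0 <-] /ltW].
move=> /(growth_le _ pP n0)/(growth_bound pP n0)[K K0 HK].
apply/lee_addgt0Pr => e e0; rewrite -EFinD.
(* From this index on, the factor [K] contributes at most [e] to the growth rate. *)
pose N := (Num.truncn (ln K / e)).+1.
apply: (@le_trans _ _ (ereal_sup [set growth P k.+1 | k in [set k | (N <= k)%N]])).
  by apply: ereal_inf_lbound; exists [set k | (N <= k)%N] => //; exact: nbhs_infty_ge.
apply: ge_ereal_sup => _ [k Nk <-]; apply/growth_le => // x.
rewrite (le_trans (HK _ _))// -{1}(lnK K0) -expRD ler_expR mulrDr addrC lerD2l.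
rewrite -ler_pdivrMr// (le_trans (ltW (truncnS_gt _)))// ler_nat.
exact: leq_trans Nk _.
Qed.

End Growth.

(** * Iterated transfer operators, Birkhoff sums and the spectral potential *)

Section Transfer.
Context {R : realType} {X : topologicalType}.
Hypotheses (cX : compact [set: X]) (x0 : X).
Implicit Types (A : (X -> R) -> X -> R) (alpha : X -> X) (phi : X -> R).

Lemma transfer_posop {alpha A} : transfer_operator alpha A -> posop A.
Proof.
case=> cA lA pA _; split=> // x; split=> [a f g cf cg|f cf f0].
  by rewrite lA.
exact: pA.
Qed.

Lemma iter_continuous {alpha} n : continuous alpha -> continuous (iter n alpha).
Proof.
move=> ca; elim: n => [|n IH] x; first exact: cvg_id.
exact: (continuous_comp (IH x) (ca _)).
Qed.

(** This allows [n] steps to be treated as a single step over [alpha ^ n], as the argument for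
    [phi / n] requires. *)
Lemma transfer_iter {alpha A} n : continuous alpha ->
  transfer_operator alpha A -> transfer_operator (iter n alpha) (iter n A).
Proof.
move=> ca hA; have pA := posop_iter n (transfer_posop hA).
split=> [|a f g cf cg|f cf f0 x|].
- exact: pA.1.
- by apply/funext => x; exact: (pA.2 x).1.
- exact: (pA.2 x).2.
elim: n {pA} => // n IH f g cf cg.
have cAn := (posop_iter n (transfer_posop hA)).1 _ cg.
by case: hA => _ _ _ hA; rewrite !iterS -hA//= -IH//; exact: cfun_comp.
Qed.

Definition birkhoff alpha phi n (x : X) : R := \sum_(i < n) phi (iter i alpha x).

Lemma cfun_birkhoff {alpha phi} n : continuous alpha -> cfun phi ->
  cfun (birkhoff alpha phi n).
Proof.
by move=> ca cp; apply: cfun_sum => i; apply: cfun_comp => //; exact: iter_continuous.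
Qed.

(** By the homological identity for [iter n A], the new outer factor e^phi moves inside as e^(phi o
    alpha^n), the last term of the next Birkhoff sum. *)
Lemma iter_Aphi {alpha A phi f} n : continuous alpha ->
  transfer_operator alpha A -> cfun phi -> cfun f ->
  iter n (Aphi A phi) f =
  iter n A (fun x => expR (birkhoff alpha phi n x) * f x).
Proof.
move=> ca hA cp cf; elim: n => [|n IH].
  by apply/funext => x; rewrite /birkhoff /= big_ord0 expR0 mul1r.
have [_ _ _ hAn] := transfer_iter n ca hA.
rewrite iterS IH /Aphi -hAn; last 2 first.
- exact: cfun_exp.
- by apply: cfunM => //; apply: cfun_exp; exact: cfun_birkhoff.
rewrite -iterS; congr (iter _ _ _); apply/funext => x.
by rewrite /birkhoff big_ord_recr/= mulrA -expRD addrC.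
Qed.

(** The limit is an infimum over positive times, so a strict bound is already witnessed at a finite
    time; [spectral_le] is the converse use. *)
Lemma spectral_lt {A phi} {t : R} : posop A -> cfun phi ->
  (spectral_potential A phi < t%:E)%E ->
  exists2 n, (0 < n)%N &
    forall x, iter n (Aphi A phi) (@Defs.one R X) x <= expR (n%:R * t).
Proof.
move=> pA cp; have pP := posop_Aphi cp pA.
rewrite /spectral_potential (growth_lim cX x0 pP).
move=> /ereal_inf_ltP[_ [n n0 <-] /ltW H].
by exists n => //; apply/growth_le.
Qed.

Lemma spectral_le {A phi n} {t : R} : posop A -> cfun phi -> (0 < n)%N ->
  (forall x, iter n (Aphi A phi) (@Defs.one R X) x <= expR (n%:R * t)) ->
  (spectral_potential A phi <= t%:E)%E.
Proof.
move=> pA cp n0; have pP := posop_Aphi cp pA.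
move=> /(growth_le cX x0 t pP n0); apply: le_trans.
rewrite /spectral_potential (growth_lim cX x0 pP).
by apply: ereal_inf_lbound; exists n.
Qed.

End Transfer.

(** * Upper bound for the t-entropy through fine partitions of unity *)

Section EntropyUpperBound.
Context {R : realType} {X : topologicalType}.
Hypothesis cX : compact [set: X].
Implicit Types (S : X -> R) (A : (X -> R) -> X -> R) (m mu : (X -> R) -> R).

(* Consecutive differences of the truncations of [T x - i] to [0, 1] are hat
   functions of [T], and their sum telescopes. *)
Lemma hat_partition {S} {e : R} : cfun S -> 0 < e ->
  exists b k (g : 'I_k -> X -> R), partition_of_unity g /\
    forall i x, 0 < g i x -> b + e * i%:R <= S x <= b + e * i%:R + 2 * e.
Proof.
move=> cS e0; have [B B0 SB] := cfun_bounded cX cS.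
(* A step [e] of [S] is a unit step of [T]. The shift gives [1 <= T <= k], so that [v 0] is 1 and
   [v k] is 0 everywhere; [- B - e] is the value of [S] corresponding to [T = 0]. *)
pose T x := e^-1 * (S x + B) + 1.
have cT : cfun T.
  apply: cfunD; last exact: cfun_cst.
  by apply: cfunZ; apply: cfunD => //; exact: cfun_cst.
pose v (i : nat) x := Num.max 0 (Num.min 1 (T x - i%:R)).
have cv i : cfun (v i).
  apply: cfun_max; first exact: cfun_cst.
  by apply: cfun_min; [exact: cfun_cst|apply: cfunB => //; exact: cfun_cst].
pose k := (Num.truncn (e^-1 * (B + B) + 1)).+1.
exists (- B - e), k, (fun i x => v i x - v i.+1 x); split; first split; [|split|].
- by move=> i; exact: cfunB.
- move=> i x; rewrite subr_ge0 /v -natr1 ge_max le_max lexx/= le_max.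
  apply/orP; right; rewrite le_min !ge_min lexx/=; apply/orP; right; lra.
- move=> x; rewrite (eq_bigr (fun i : 'I_k => - (v i.+1 x - v i x))); last first.
    by move=> i _; rewrite opprB.
  rewrite sumrN -(big_mkord xpredT (fun i => v i.+1 x - v i x)) telescope_sumr//.
  have /andP[S1 S2] : - B <= S x <= B by rewrite -ler_norml.
  have T1 : 1 <= T x by rewrite lerDr mulr_ge0//; [rewrite invr_ge0 ltW|lra].
  have Tk : T x <= k%:R.
    rewrite (le_trans _ (ltW (truncnS_gt _)))// lerD2r ler_wpM2l//.
      by rewrite invr_ge0 ltW.
    lra.
  have -> : v k x = 0.
    by apply/max_idPl; rewrite ge_min subr_le0 Tk orbT.
  have -> : v 0%N x = 1.
    rewrite /v subr0; have /min_idPl -> := T1.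
    by apply/max_idPr; exact: ler01.
  by rewrite sub0r opprK.
- move=> i x; rewrite subr_gt0 /v -natr1 => vv.
  have ST : S x = e * (T x - 1) - B by rewrite /T; field; rewrite gt_eqF.
  have Ti : i%:R <= T x.
    rewrite leNgt; apply/negP => H; move: vv; rewrite ltNge => /negP; apply.
    rewrite (_ : Num.max 0 (Num.min 1 (T x - i%:R)) = 0).
      by rewrite le_max lexx.
    by apply/max_idPl; rewrite ge_min; apply/orP; right; lra.
  have iT : T x <= i%:R + 2.
    rewrite leNgt; apply/negP => H; move: vv; rewrite ltNge => /negP; apply.
    rewrite (_ : Num.min 1 (T x - (i%:R + 1)) = 1).
      by rewrite ge_max !le_max lexx/= !ge_min lexx/= orbT.
    by apply/min_idPl; lra.
  have := ler_wpM2l (ltW e0) Ti; have := ler_wpM2l (ltW e0) iT.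
  rewrite ST; lra.
Qed.

(** The tangent to ln at [a] bounds the summand by an expression linear in [m (A^n g)], so the sum
    over a partition can be taken inside [m]. *)
Lemma tsummand_le {A n mu m} {g : X -> R} (a : R) : 0 < a ->
  0 <= mu g -> 0 <= m (iter n A g) ->
  (tsummand A n mu m g <=
   (a^-1 * m (iter n A g) - mu g + mu g * ln a)%:E)%E.
Proof.
move=> a0; rewrite le_eqVlt /tsummand => /predU1P[<-|p0] y0.
  by rewrite eqxx mul0r subr0 addr0 lee_fin mulr_ge0// invr_ge0 ltW.
rewrite gt_eqF//.
set y := m _ in y0 *; set p := mu g in p0 *.
rewrite -lee_pdivlMl// -EFinM.
rewrite lnE_le; last by rewrite mulr_ge0// invr_ge0 ltW.
have -> : p^-1 * (a^-1 * y - p + p * ln a) = (p^-1 * a^-1 * y - 1) + ln a.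
  by field; rewrite !gt_eqF.
rewrite expRD lnK//.
have := expR_ge1Dx (p^-1 * a^-1 * y - 1); rewrite [1 + _]addrC subrK.
move=> /(ler_wpM2r (ltW a0)); apply: le_trans.
by rewrite le_eqVlt; apply/orP; left; apply/eqP; field; rewrite !gt_eqF.
Qed.

Lemma tau_n_le {A mu n S} {theta e : R} : posop A -> state mu -> cfun S ->
  0 < theta -> 0 < e ->
  (forall x, iter n A (fun y => expR (S y)) x <= theta) ->
  (tau_n A mu n <= (ln theta - mu S + 2 * e)%:E)%E.
Proof.
move=> pA smu cS t0 e0 AS; have pmu := state_plf smu.
have [b [k [g [gD gS]]]] := hat_partition cS e0; have [cg [g0 g1]] := gD.
apply: (@le_trans _ _ (tau_nD A mu n g)).
  by apply: ereal_inf_lbound; exists k, g.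
apply: ge_ereal_sup => _ [m sm <-].
pose M f := m (iter n A f).
have pM : plf M := plf_comp (state_plf sm) (posop_iter n pA).
(* Where [g i] is positive, [S] lies between [s i] and [s i + 2 * e]. The lower side gives [Mle],
   whose 1 cancels the total mass [mu1]; the upper side gives [muS]. *)
pose s (i : 'I_k) := b + e * i%:R.
pose a i := theta * expR (- s i).
have a0 i : 0 < a i by rewrite mulr_gt0 ?expR_gt0.
have mug i : 0 <= mu (g i) by apply: pmu.2.
apply: (@le_trans _ _ (\sum_(i < k)
    ((a i)^-1 * M (g i) - mu (g i) + mu (g i) * ln (a i))%:E)%E).
  by apply: lee_sum => i _; apply: tsummand_le => //; exact: pM.2.
rewrite sumEFin lee_fin big_split/= sumrB.
have cSg i : cfun (fun x => expR (s i) * g i x) by exact: cfunZ.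
have Mle : \sum_(i < k) (a i)^-1 * M (g i) <= 1.
  have -> : \sum_(i < k) (a i)^-1 * M (g i) =
            theta^-1 * M (fun x => \sum_(i < k) expR (s i) * g i x).
    rewrite plf_sum// big_distrr/=; apply: eq_bigr => i _.
    by rewrite plfZ// mulrA /a expRN invfM invrK.
  rewrite mulrC ler_pdivrMr// mul1r.
  have cE := cfun_exp cS.
  apply: (@le_trans _ _ (M (fun x => expR (S x)))).
    apply: plf_le => // [|x]; first exact: cfun_sum.
    rewrite -[leRHS]mulr1 -(g1 x) big_distrr/=; apply: ler_sum => i _.
    have := g0 i x; rewrite le_eqVlt => /predU1P[<-|gx]; first by rewrite !mulr0.
    by rewrite ler_wpM2r// ler_expR; case/andP: (gS i x gx).
  rewrite -(state_cst theta sm); apply: (plf_le (m := m)) => //.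
  - exact: state_plf.
  - exact: (posop_iter n pA).1.
  - exact: cfun_cst.
have mu1 : \sum_(i < k) mu (g i) = 1.
  rewrite -plf_sum// -[RHS](state_cst 1 smu); congr mu.
  by apply/funext => x; rewrite g1.
have muS : mu S <= \sum_(i < k) mu (g i) * s i + 2 * e.
  rewrite -[2 * e]mul1r -[X in X * (2 * e)]mu1 mulr_suml -big_split/=.
  have -> : \sum_(i < k) (mu (g i) * s i + mu (g i) * (2 * e)) =
            mu (fun x => \sum_(i < k) (s i + 2 * e) * g i x).
    rewrite plf_sum//; last by move=> i; exact: cfunZ.
    by apply: eq_bigr => i _; rewrite plfZ// -mulrDr mulrC.
  apply: plf_le => // [|x]; first by apply: cfun_sum => i; exact: cfunZ.
  rewrite -[leLHS]mulr1 -[X in _ * X <= _](g1 x) big_distrr/=; apply: ler_sum => i _.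
  have := g0 i x; rewrite le_eqVlt => /predU1P[<-|gx]; first by rewrite !mulr0.
  by rewrite ler_wpM2r//; case/andP: (gS i x gx).
have -> : \sum_(i < k) mu (g i) * ln (a i) =
          ln theta - \sum_(i < k) mu (g i) * s i.
  rewrite -[ln theta in RHS]mul1r -[in RHS]mu1 mulr_suml -sumrB.
  apply: eq_bigr => i _.
  by rewrite /a lnM ?posrE ?expR_gt0// expRK; ring.
rewrite mu1; lra.
Qed.

End EntropyUpperBound.

(** * Convexity estimates and approximate maximization of weighted logarithms *)

Section WeightedLogarithm.
Context {R : realType}.

Lemma ln_le_subr1 (x : R) : 0 < x -> ln x <= x - 1.
Proof.
move=> x0; have := @le_ln1Dx R (x - 1).
by rewrite [1 + _]addrC subrK; apply; lra.
Qed.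

(** Apply ln u <= u - 1 at u = 1 / (1 + s), where u <= 2 on this range. *)
Lemma ln1D_ge (s : R) : - (1 / 2) <= s -> s - 2 * s ^+ 2 <= ln (1 + s).
Proof.
move=> s12; have s0 : 0 < 1 + s by lra.
have := @ln_le_subr1 (1 + s)^-1; rewrite invr_gt0 lnV// => /(_ s0).
have -> : (1 + s)^-1 = 1 - s + s ^+ 2 * (1 + s)^-1 by field; rewrite gt_eqF.
have : s ^+ 2 * (1 + s)^-1 <= s ^+ 2 * 2.
  rewrite ler_wpM2l ?sqr_ge0// -[leRHS]invrK lef_pV2 ?posrE ?invr_gt0//.
  lra.
lra.
Qed.

(** Bound each exponential below by its tangent at the mean [b]; the linear terms cancel in the
    sum. *)
Lemma expR_mean (n : nat) (a : 'I_n -> R) : (0 < n)%N ->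
  expR (n%:R^-1 * \sum_(i < n) a i) <= n%:R^-1 * \sum_(i < n) expR (a i).
Proof.
move=> n0; have nR : 0 < n%:R :> R by rewrite ltr0n.
set b := _^-1 * _.
have : \sum_(i < n) expR b * (1 + (a i - b)) <= \sum_(i < n) expR (a i).
  apply: ler_sum => i _; rewrite -{2}(subrK b (a i)) [leRHS]expRD mulrC.
  by rewrite ler_wpM2r ?expR_ge0// expR_ge1Dx.
rewrite -big_distrr/= big_split/= sumrB !sumr_const card_ord -[b *+ n]mulr_natl.
rewrite {3}/b mulVKf ?gt_eqF// subrr addr0 => H.
by rewrite ler_pdivlMl// mulrC.
Qed.

(* First-order optimality for the concave function [y |-> \sum_i p i * ln (y i)]
   at an approximate maximum: a larger directional derivative would force a
   gain of a fixed size along the segment towards [z]. *)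
Lemma approx_max {k} {p c : 'I_k -> R} {B e : R} (K : set ('I_k -> R)) :
  (forall i, 0 <= p i) -> (forall i, p i != 0 -> 0 < c i) -> K !=set0 ->
  (forall y z t, 0 <= t -> t <= 1 -> K y -> K z ->
     K (fun i => (1 - t) * y i + t * z i)) ->
  (forall y i, K y -> p i != 0 -> c i <= y i <= B) -> 0 < e ->
  exists2 y, K y &
    forall z, K z -> \sum_(i < k) p i * (z i / y i) <= \sum_(i < k) p i + e.
Proof.
move=> p0 c0 [y0 Ky0] cvxK bK e0.
pose F y := \sum_(i < k) p i * ln (y i).
(* The ratios r = z / y lie in [0, B / c], so [Q] dominates the weighted sum of (r - 1)^2, which
   controls the second-order loss. *)
pose Q := \sum_(i < k) p i * ((B / c i) ^+ 2 + 1).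
have Q0 : 0 <= Q.
  by apply: sumr_ge0 => i _; rewrite mulr_ge0// addr_ge0// sqr_ge0.
have D0 : 0 < 4 * Q + 2 * e by lra.
(* The loss [2 * t ^+ 2 * Q] is then at most half of the first-order gain [t * e], and [t <= 1 / 2]
   keeps [t * (r - 1)] in the range of [ln1D_ge]. *)
pose t := e / (4 * Q + 2 * e).
have t0 : 0 < t by rewrite divr_gt0.
have t12 : t <= 1 / 2 by rewrite ler_pdivrMr//; lra.
have tQ : 2 * t * Q <= e / 2.
  have : t * (4 * Q + 2 * e) = e by rewrite /t; field; rewrite gt_eqF.
  have := mulr_gt0 t0 e0; lra.
have hF : has_sup [set F y | y in K].
  split; first by exists (F y0), y0.
  exists (\sum_(i < k) p i * ln B) => _ [y Ky <-]; apply: ler_sum => i _.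
  have [->|pi0] := eqVneq (p i) 0; first by rewrite !mul0r.
  have /andP[cy yB] := bK y i Ky pi0; have y_gt0 := lt_le_trans (c0 i pi0) cy.
  by rewrite ler_wpM2l// ler_ln ?posrE ?(lt_le_trans y_gt0).
(* Choosing [y] within [t * (e / 2)] of the supremum makes the remaining half of the gain
   contradictory. *)
have te0 : 0 < t * (e / 2) by rewrite mulr_gt0//; lra.
have [_ [y Ky <-] yM] := sup_adherent te0 hF.
exists y => // z Kz; rewrite leNgt; apply/negP => Hz.
pose w i := (1 - t) * y i + t * z i.
have Kw : K w by apply: cvxK => //; lra.
have : F w <= sup [set F y | y in K] by apply: ub_le_sup; [case: hF|exists w].
suff : F y + t * (e / 2) <= F w by lra.
have : \sum_(i < k) (p i * ln (y i) + (t * (p i * (z i / y i)) - t * p i)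
          - 2 * t ^+ 2 * (p i * ((B / c i) ^+ 2 + 1))) <= F w.
  apply: ler_sum => i _.
  have [->|pi0] := eqVneq (p i) 0; first by lra.
  have /andP[cy yB] := bK y i Ky pi0; have /andP[cz zB] := bK z i Kz pi0.
  have ci := c0 i pi0; have yi := lt_le_trans ci cy.
  have zi := lt_le_trans ci cz.
  set r := z i / y i.
  have r0 : 0 <= r by rewrite divr_ge0 ?ltW.
  have rB : r <= B / c i.
    by apply: ler_pM => //; rewrite ?invr_ge0 ?lef_pV2 ?posrE// ?ltW.
  have wi : w i = y i * (1 + t * (r - 1)).
    by rewrite /w /r; field; rewrite gt_eqF.
  have s12 : - (1 / 2) <= t * (r - 1) by have := mulr_ge0 (ltW t0) r0; lra.
  have s0 : 0 < 1 + t * (r - 1) by lra.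
  rewrite wi lnM ?posrE//.
  have r2 : r ^+ 2 <= (B / c i) ^+ 2 by rewrite ler_sqr ?nnegrE// (le_trans r0).
  have : (t * (r - 1)) ^+ 2 <= t ^+ 2 * ((B / c i) ^+ 2 + 1).
    by rewrite exprMn ler_wpM2l ?sqr_ge0//; lra.
  have := ln1D_ge _ s12 => H1 H2.
  have : t * (r - 1) - 2 * (t ^+ 2 * ((B / c i) ^+ 2 + 1)) <= ln (1 + t * (r - 1)).
    lra.
  move=> /(ler_wpM2l (p0 i)); lra.
rewrite !sumrB !big_split/= sumrN -!big_distrr/= -/(F y) -/Q.
have : 0 <= t * (\sum_(i < k) p i * (z i / y i) - (\sum_(i < k) p i + e)).
  by apply: mulr_ge0; rewrite ?subr_ge0 ltW.
have := ler_wpM2l (ltW t0) tQ.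
lra.
Qed.

End WeightedLogarithm.

(** * From a partition of unity to a potential *)

Section EntropyLowerBound.
Context {R : realType} {X : topologicalType}.
Hypotheses (cX : compact [set: X]) (x0 : X).
Implicit Types (A : (X -> R) -> X -> R) (m mu : (X -> R) -> R).

Lemma ln_partition {mu k} {g : 'I_k -> X -> R} {d : 'I_k -> R} :
  state mu -> partition_of_unity g -> (forall i, 0 < d i) ->
  exists phi, [/\ cfun phi,
    forall x, expR (phi x) = \sum_(i < k) d i * g i x &
    \sum_(i < k) mu (g i) * ln (d i) <= mu phi].
Proof.
move=> smu [cg [g0 g1]] d0.
pose h x := \sum_(i < k) d i * g i x.
have h0 x : 0 < h x.
  have h_ge0 i : xpredT i -> 0 <= d i * g i x.
    by move=> _; rewrite mulr_ge0// ltW.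
  rewrite lt_neqAle sumr_ge0// andbT eq_sym; apply/negP => /eqP.
  move/(psumr_eq0P h_ge0) => H.
  have := g1 x; rewrite big1 => [/esym/eqP|i _]; first by rewrite oner_eq0.
  by have /eqP := H i isT; rewrite mulf_eq0 gt_eqF//= => /eqP.
have ch : cfun h by apply: cfun_sum => i; exact: cfunZ.
exists (fun x => ln (h x)); split.
- exact: cfun_ln.
- by move=> x; rewrite lnK ?posrE.
have -> : \sum_(i < k) mu (g i) * ln (d i) =
          mu (fun x => \sum_(i < k) ln (d i) * g i x).
  rewrite (plf_sum (state_plf smu)); last by move=> i; exact: cfunZ.
  by apply: eq_bigr => i _; rewrite (plfZ _ (state_plf smu))// mulrC.
apply: (plf_le (state_plf smu)) => [||x].
- by apply: cfun_sum => i; exact: cfunZ.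
- exact: cfun_ln.
(* Jensen's inequality with weights [g i x]: after ln u <= u - 1 at u = d_i / h, the right-hand side
   sums to 0. *)
have : \sum_(i < k) (ln (d i) - ln (h x)) * g i x <=
       \sum_(i < k) (d i / h x - 1) * g i x.
  apply: ler_sum => i _; rewrite ler_wpM2r// -ln_div ?posrE//.
  by apply: ln_le_subr1; rewrite divr_gt0.
under eq_bigr do rewrite mulrBl.
under [leRHS]eq_bigr do rewrite mulrBl mulrAC.
rewrite !sumrB -!big_distrr/= -mulr_suml g1 -/(h x) divff ?gt_eqF//.
lra.
Qed.

Lemma state_bary {k} {p : 'I_k -> R} (x : 'I_k -> X) :
  (forall i, 0 <= p i) -> \sum_(i < k) p i = 1 ->
  state (fun f : X -> R => \sum_(i < k) p i * f (x i)).
Proof.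
move=> p0 p1; split=> [a f g _ _|f _ f0|].
- rewrite big_distrr/= -big_split/=; apply: eq_bigr => i _; ring.
- by apply: sumr_ge0 => i _; rewrite mulr_ge0.
- by rewrite -[RHS]p1; apply: eq_bigr => i _; rewrite /Defs.one mulr1.
Qed.

Lemma tau_nD_potential {A mu n k} {g : 'I_k -> X -> R} {T e : R} :
  posop A -> state mu -> partition_of_unity g ->
  (tau_nD A mu n g < T%:E)%E -> 0 < e ->
  exists phi theta, [/\ cfun phi, 0 < theta,
    forall x, iter n A (fun y => expR (phi y)) x <= theta &
    ln theta - mu phi <= T + e].
Proof.
move=> pA smu gD tauT e0; have pB := posop_iter n pA.
have [cg [g0 g1]] := gD; have pmu := state_plf smu.
pose p i := mu (g i); pose b i := iter n A (g i).
have p0 i : 0 <= p i by exact: pmu.2.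
have p1 : \sum_(i < k) p i = 1.
  rewrite -plf_sum// -[RHS](state_cst 1 smu); congr mu.
  by apply/funext => x; rewrite g1.
have cb i : cfun (b i) by exact: pB.1.
have b0 i x : 0 <= b i x by apply: (pB.2 x).2.
have [C C0 BC] := cfun_bounded cX (pB.1 _ (cfun_cst 1)).
have bC x : \sum_(i < k) b i x <= C.
  rewrite -(plf_sum (pB.2 x))//; apply: le_trans (BC x).
  apply: le_trans (ler_norm _); rewrite le_eqVlt; apply/orP; left; apply/eqP.
  by congr (iter n A _ x); apply/funext => y; rewrite g1.
suff [d [theta [d0 theta0 dtheta dT]]] : exists (d : 'I_k -> R) theta,
    [/\ forall i, 0 < d i, 0 < theta,
        forall x, \sum_(i < k) d i * b i x <= theta &
        ln theta - \sum_(i < k) p i * ln (d i) <= T + e].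
  have [phi [cphi ephi muphi]] := ln_partition smu gD d0.
  exists phi, theta; split => // [x|]; last by rewrite -/p in muphi; lra.
  have -> : (fun y => expR (phi y)) = (fun y => \sum_(i < k) d i * g i y).
    exact/funext.
  rewrite (plf_sum (pB.2 x)); last by move=> i; exact: cfunZ.
  apply: le_trans (dtheta x); rewrite le_eqVlt; apply/orP; left; apply/eqP.
  by apply: eq_bigr => i _; rewrite (plfZ _ (pB.2 x)).
have [[j [pj bj]]|nb] := pselect (exists j, p j != 0 /\ forall x, b j x = 0).
  (* As [A^n g_j] vanishes, [d j] is free; this value makes [p j * ln (d j)] equal to [ln C - T]. *)
  exists (fun i => if i == j then expR ((ln C - T) / p j) else 1), C.
  split => // [i|x|]; first by case: ifP; rewrite ?expR_gt0.
    apply: le_trans (bC x); apply: ler_sum => i _.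
    by have [->|] := eqVneq i j; [rewrite bj mulr0|rewrite mul1r].
  rewrite (bigD1 j)//= eqxx expRK big1 ?addr0 => [|i /negPf ->].
    by rewrite mulrC divfK//; lra.
  by rewrite ln1 mulr0.
have /choice[xs bxs] : forall j, exists x, p j != 0 -> 0 < b j x.
  move=> j; have [pj|pj] := eqVneq (p j) 0; first by exists x0.
  apply: contrapT => H; apply: nb; exists j; split => // x.
  apply: contrapT => /eqP bx; apply: H; exists x => _.
  by rewrite lt_neqAle eq_sym bx b0.
(* This state is positive on every [b i] of nonzero weight at once. *)
pose ms f := \sum_(i < k) p i * f (xs i) : R.
have sms : state ms by exact: state_bary.
have ms0 i : p i != 0 -> 0 < ms (b i).
  move=> pi; rewrite /ms (bigD1 i)//= ltr_pwDl//.
    by rewrite mulr_gt0 ?bxs// lt_neqAle eq_sym pi p0.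
  by apply: sumr_ge0 => l _; rewrite mulr_ge0.
(* Sized so that [(1 + eta) / (1 - eta) + eta <= 1 + 5 * eta] and [5 * eta <= e]. *)
pose eta := e / (5 * (1 + e)).
have e5 : 0 < 5 * (1 + e) by lra.
have eta0 : 0 < eta by rewrite divr_gt0.
have eta1 : eta <= 1 / 5 by rewrite ler_pdivrMr//; lra.
have etae : 5 * eta <= e.
  have : 5 * eta * (1 + e) = e by rewrite /eta; field; rewrite gt_eqF//; lra.
  have := mulr_gt0 eta0 e0; lra.
(* A share [eta] of [ms] keeps the values at [b i] above [eta * ms (b i)], the uniform lower bound
   that [approx_max] needs. *)
pose mix m f : R := (1 - eta) * m f + eta * ms f.
have smix m : state m -> state (mix m).
  by move=> sm; apply: state_conv => //; lra.
pose K := [set y | exists2 m, state m & y = (fun i => mix m (b i))].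
have [_ [m0 sm0 ->] Hopt] : exists2 y, K y & forall z, K z ->
    \sum_(i < k) p i * (z i / y i) <= \sum_(i < k) p i + eta.
  apply: (@approx_max _ _ _ (fun i => eta * ms (b i)) C) => //.
  - by move=> i pi; rewrite mulr_gt0 ?ms0.
  - by exists (fun i => mix ms (b i)), ms.
  - move=> _ _ t t0 t1 [m1 sm1 ->] [m2 sm2 ->].
    exists (fun f => (1 - t) * m1 f + t * m2 f); first exact: state_conv.
    by apply/funext => i; rewrite /mix; ring.
  - move=> _ i [m sm ->] pi; apply/andP; split.
      rewrite lerDr mulr_ge0//; first by lra.
      exact: (state_plf sm).2.
    rewrite -(state_cst C (smix _ sm)).
    apply: (plf_le (state_plf (smix _ sm))) => [||x]; [exact: cb|exact: cfun_cst|].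
    apply: le_trans (bC x); rewrite (bigD1 i)//= lerDl.
    by apply: sumr_ge0.
pose y i := mix m0 (b i).
have y0 i : p i != 0 -> 0 < y i.
  move=> pi; rewrite /y /mix ltr_wpDl//; last by rewrite mulr_gt0 ?ms0.
  by rewrite mulr_ge0//; [lra|exact: (state_plf sm0).2].
have y_ge0 i : 0 <= y i.
  by apply: (state_plf (smix _ sm0)).2.
(* Test optimality against evaluation at [x], mixed likewise; dropping its nonnegative [ms] part
   leaves the factor [1 - eta]. *)
have dx x : \sum_(i < k) p i / y i * b i x <= (1 + eta) / (1 - eta).
  rewrite ler_pdivlMr; last by lra.
  rewrite p1 in Hopt; apply: le_trans (Hopt (fun i => mix (fun f => f x) (b i)) _).
    rewrite mulr_suml; apply: ler_sum => i _.
    rewrite -/(y i) -!mulrA ler_wpM2l//.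
    have : 0 <= (y i)^-1 * (eta * ms (b i)).
      rewrite mulr_ge0 ?invr_ge0// mulr_ge0//; first exact: ltW.
      exact: (state_plf sms).2.
    by rewrite /mix/=; lra.
  by exists (fun f => f x) => //; exact: state_eval.
(* The term [eta / C] makes every weight positive, even where [p i = 0], and adds at most [eta] to
   the sum because the [b i] add up to at most [C]. *)
exists (fun i => p i / y i + eta / C), ((1 + eta) / (1 - eta) + eta).
have dge0 i : 0 <= p i / y i by rewrite divr_ge0.
have etaC : 0 < eta / C by rewrite divr_gt0.
have th0 : 0 < (1 + eta) / (1 - eta) + eta.
  by rewrite addr_gt0// divr_gt0//; lra.
split => // [i|x|].
- by rewrite ltr_wpDl.
- under eq_bigr do rewrite mulrDl.
  rewrite big_split/= lerD// -big_distrr/=.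
  rewrite (le_trans (ler_wpM2l (ltW etaC) (bC x)))//.
  by rewrite divfK// gt_eqF.
have lnth : ln ((1 + eta) / (1 - eta) + eta) <= e.
  apply: le_trans (ln_le_subr1 _ th0) _; apply: le_trans etae.
  have : (1 + eta) / (1 - eta) <= 1 + 4 * eta.
    rewrite ler_pdivrMr; last lra.
    have := mulr_ge0 (ltW eta0) (ltW eta0); have := ler_wpM2l (ltW eta0) eta1; lra.
  lra.
suff : - \sum_(i < k) p i * ln (p i / y i + eta / C) <= T by lra.
rewrite -lee_fin; apply/ltW; apply: le_lt_trans tauT.
apply: le_trans (ereal_sup_ubound _); last first.
  by exists (mix m0); [exact: smix|reflexivity].
rewrite -sumrN -sumEFin; apply: lee_sum => i _; rewrite /tsummand -/(p i) -/(b i).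
have [->|pi0] := eqVneq (p i) 0; first by rewrite mul0r oppr0.
have pi : 0 < p i by rewrite lt_neqAle eq_sym pi0 p0.
rewrite -/(y i) /lnE mulf_eq0 invr_eq0 (negPf pi0) (gt_eqF (y0 _ pi0))/=.
rewrite -EFinM lee_fin -mulrN ler_wpM2l// -[y i / p i]invrK invf_div lnV; last first.
  by rewrite posrE divr_gt0// y0.
rewrite lerN2 ler_ln ?posrE ?divr_gt0 ?y0//; first by rewrite lerDl ltW.
by rewrite ltr_wpDl.
Qed.

End EntropyLowerBound.

(** * Spectral potential of the averaged potential [phi / n] *)

Section MeanPotential.
Context {R : realType} {X : topologicalType}.
Hypotheses (cX : compact [set: X]) (x0 : X).
Context {alpha : X -> X} {A : (X -> R) -> X -> R}.
Hypotheses (calpha : continuous alpha) (hA : transfer_operator alpha A).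
Implicit Types (phi : X -> R) (mu : (X -> R) -> R).

Lemma birkhoffD (beta : X -> X) phi a b x :
  birkhoff beta phi (a + b) x =
  birkhoff beta phi a x + birkhoff beta phi b (iter a beta x).
Proof.
rewrite /birkhoff big_split_ord/=; congr (_ + _).
by apply: eq_bigr => i _; rewrite -iterD addnC.
Qed.

(** The times below [N * n] are grouped by their residue [j] modulo [n]. *)
Lemma birkhoffM phi N n x :
  birkhoff alpha phi (N * n) x =
  \sum_(j < n) birkhoff (iter n alpha) phi N (iter j alpha x).
Proof.
elim: N x => [|N IH] x.
  rewrite mul0n {1}/birkhoff big_ord0 big1// => j _.
  by rewrite /birkhoff big_ord0.
rewrite mulSn birkhoffD IH {1}/birkhoff -big_split/=; apply: eq_bigr => j _.
rewrite -add1n birkhoffD; congr (_ + _).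
  by rewrite /birkhoff big_ord1.
by rewrite /= -!iterD addnC.
Qed.

Lemma mu_birkhoff {mu phi} n : inv_state alpha mu -> cfun phi ->
  mu (birkhoff alpha phi n) = n%:R * mu phi.
Proof.
move=> [smu imu] cp; have pmu := state_plf smu.
have ci i : cfun (fun x => phi (iter i alpha x)).
  by apply: cfun_comp => //; exact: iter_continuous.
rewrite plf_sum// (eq_bigr (fun=> mu phi)).
  by rewrite sumr_const card_ord mulr_natl.
move=> [i _] _ /=; elim: i => // i <-.
rewrite -[RHS]imu//; congr mu; apply/funext => x.
by rewrite -iterSr.
Qed.

(** The innermost [j] steps remove the shift by [alpha ^ j] at cost [C ^+ j], the next [N * n] give
    [theta ^+ N], and the last [n - j] cost [C ^+ (n - j)]. The extra [n] steps make the total time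
    the same for all [j]. *)
Lemma iter_transfer_birkhoff_le {phi theta} {C : R} {N n} j :
  cfun phi -> 0 < theta ->
  (forall x, iter n A (fun y => expR (phi y)) x <= theta) ->
  0 <= C -> (forall x, A (@Defs.one R X) x <= C) -> (j <= n)%N ->
  forall x, iter (N * n + n) A
    (fun y => expR (birkhoff (iter n alpha) phi N (iter j alpha y))) x <=
    C ^+ n * theta ^+ N.
Proof.
move=> cp t0 At C0 AC jn x.
have pA := transfer_posop hA.
have cn := iter_continuous n calpha.
set G := birkhoff (iter n alpha) phi N.
have cG : cfun (fun y => expR (G y)) by apply: cfun_exp; exact: cfun_birkhoff.
have Gt y : iter (N * n) A (fun y => expR (G y)) y <= theta ^+ N.
  have c1 : cfun (@Defs.one R X) := cfun_cst 1.
  have := iter_Aphi N cn (transfer_iter n calpha hA) cp c1.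
  rewrite iterM -/G => H.
  have -> : (fun y => expR (G y)) = (fun y => expR (G y) * Defs.one R y).
    by apply/funext => z; rewrite /Defs.one mulr1.
  rewrite -H; apply: posop_iter_le; last 2 first.
  - exact: ltW.
  - move=> z; apply: le_trans (At z); rewrite /Aphi.
    rewrite le_eqVlt; apply/orP; left; apply/eqP.
    by congr (iter n A _ z); apply/funext => w; rewrite /Defs.one mulr1.
  - by apply: posop_Aphi => //; exact: posop_iter.
have [_ _ _ hAj] := transfer_iter j calpha hA.
have -> : (N * n + n = (n - j) + N * n + j)%N by rewrite addnAC subnK// addnC.
rewrite iterD.
have -> : iter j A (fun y => expR (G (iter j alpha y))) =
    (fun y => expR (G y) * iter j A (@Defs.one R X) y).
  rewrite -hAj//; last exact: cfun_cst.
  by congr (iter j A _); apply/funext => y; rewrite /Defs.one mulr1.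
rewrite iterD.
have pj := posop_iter j pA; have pN := posop_iter (N * n) pA.
have pnj := posop_iter (n - j) pA.
have cj := pj.1 _ (cfun_cst 1).
have HN y : iter (N * n) A (fun y => expR (G y) * iter j A (@Defs.one R X) y) y <=
    C ^+ j * theta ^+ N.
  apply: (@le_trans _ _ (iter (N * n) A (fun y => C ^+ j * expR (G y)) y)).
    apply: (plf_le (pN.2 y)) => [||z]; [exact: cfunM|exact: cfunZ|].
    by rewrite mulrC ler_wpM2r ?expR_ge0//; exact: posop_iter_le.
  by rewrite (plfZ _ (pN.2 y))// ler_wpM2l// exprn_ge0.
apply: (@le_trans _ _ (iter (n - j) A (fun=> C ^+ j * theta ^+ N) x)).
  by apply: (plf_le (pnj.2 x)) => //; [apply: pN.1; exact: cfunM|exact: cfun_cst].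
rewrite (plf_cst _ (pnj.2 x)) -[in leRHS](subnKC jn) exprD [leRHS]mulrAC.
rewrite ler_wpM2l//; last exact: posop_iter_le.
by rewrite mulr_ge0// exprn_ge0// ltW.
Qed.

(* Along [N * n] steps the Birkhoff sum of [phi / n] is the average over [j < n]
   of the sums of [phi] along [alpha ^ n] started at [alpha ^ j x], each of which
   contributes growth [theta] per [n] steps. *)
Lemma spectral_mean {phi theta n} : cfun phi -> (0 < n)%N -> 0 < theta ->
  (forall x, iter n A (fun y => expR (phi y)) x <= theta) ->
  (spectral_potential A (fun x => (n%:R^-1 * phi x)%R) <= (ln theta / n%:R)%:E)%E.
Proof.
move=> cp n0 t0 At; have pA := transfer_posop hA.
have nR : 0 < n%:R :> R by rewrite ltr0n.
pose psi x := n%:R^-1 * phi x; have cpsi : cfun psi by exact: cfunZ.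
have [C C0 AC'] := cfun_bounded cX (pA.1 _ (cfun_cst 1)).
have AC x : A (@Defs.one R X) x <= C := le_trans (ler_norm _) (AC' x).
have [b b0 bpsi] := cfun_bounded cX (cfun_birkhoff n calpha cpsi).
(* [expR b] pays for the last [n] terms of the Birkhoff sum, [C ^+ n] for the shifts. *)
pose K := expR b * C ^+ n.
have K0 : 0 < K by rewrite mulr_gt0 ?expR_gt0 ?exprn_gt0.
have HK N x : iter (N * n + n) (Aphi A psi) (@Defs.one R X) x <= K * theta ^+ N.
  rewrite (iter_Aphi _ calpha hA cpsi (cfun_cst 1)).
  set P := iter (N * n + n) A; have pP : posop P by exact: posop_iter.
  pose E (j : 'I_n) y :=
    expR (birkhoff (iter n alpha) phi N (iter j alpha y)).
  have cE j : cfun (E j).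
    apply: cfun_exp; apply: (cfun_comp (iter_continuous j calpha)).
    by apply: cfun_birkhoff => //; exact: iter_continuous.
  apply: (@le_trans _ _ (P (fun y => expR b * (n%:R^-1 * \sum_(j < n) E j y)) x)).
    apply: (plf_le (pP.2 x)) => [||y].
    - apply: cfunM; last exact: cfun_cst.
      by apply: cfun_exp; exact: cfun_birkhoff.
    - by do 2!apply: cfunZ; exact: cfun_sum.
    rewrite /Defs.one mulr1 birkhoffD addrC expRD ler_pM ?expR_ge0//.
      by rewrite ler_expR (le_trans (ler_norm _)).
    rewrite /birkhoff -mulr_sumr -/(birkhoff alpha phi (N * n) y) birkhoffM.
    exact: expR_mean.
  have cSE := cfun_sum cE.
  rewrite (plfZ _ (pP.2 x) (cfunZ _ cSE)) (plfZ _ (pP.2 x) cSE).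
  rewrite (plf_sum (pP.2 x))// -mulrA ler_wpM2l ?expR_ge0// ler_pdivrMl//.
  have EB (j : 'I_n) : P (E j) x <= C ^+ n * theta ^+ N.
    by apply: iter_transfer_birkhoff_le => //; [exact: ltW|exact: ltnW].
  apply: le_trans (ler_sum _ (fun j _ => EB j)) _.
  by rewrite sumr_const card_ord mulr_natl.
apply/lee_addgt0Pr => e e0; rewrite -EFinD.
(* The total time is [(N + 1) * n] but only [theta ^+ N] is available, so both [K] and one missing
   factor [theta] must be absorbed by [(N + 1) * n * e]. *)
pose N := Num.truncn ((ln K - ln theta) / (n%:R * e)).
apply: (spectral_le cX x0 (n := N * n + n)) => // [|x].
  by rewrite addn_gt0 n0 orbT.
apply: le_trans (HK N x) _.
rewrite -{1}(lnK K0) -{1}(lnK t0) -expRM_natl -expRD ler_expR natrD natrM.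
have : ln K - ln theta <= N.+1%:R * (n%:R * e).
  by rewrite -ler_pdivrMr ?mulr_gt0// ltW// truncnS_gt.
rewrite -natr1.
have -> : (N%:R * n%:R + n%:R) * (ln theta / n%:R + e) =
    (N%:R + 1) * ln theta + (N%:R + 1) * (n%:R * e).
  by field; rewrite gt_eqF.
lra.
Qed.

End MeanPotential.

(** * The variational formula for the t-entropy *)

Theorem theorem1p9 (R : realType) (X : topologicalType)
    (hX : hausdorff_space X) (cX : compact [set: X])
    (alpha : X -> X) (calpha : continuous alpha)
    (A : (X -> R) -> (X -> R)) (hA : transfer_operator alpha A)
    (mu : (X -> R) -> R) (hmu : inv_state alpha mu) :
  t_entropy A mu =
  ereal_inf [set (spectral_potential A phi - (mu phi)%:E)%E | phi in @cfun R X].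
Proof.
have pA := transfer_posop hA; have smu := hmu.1.
have [x0] := state_inhab smu.
apply/eqP; rewrite eq_le; apply/andP; split.
- apply: le_ereal_inf_tmp => _ [phi cphi <-]; apply: lee_above => t.
  rewrite lteBlDr// -EFinD => /(spectral_lt cX x0 pA cphi)[n n0 Hn].
  have nR : 0 < n%:R :> R by rewrite ltr0n.
  apply/lee_addgt0Pr => e e0; rewrite -EFinD.
  apply: (@le_trans _ _ (tau_n A mu n * (n%:R^-1)%:E)%E).
    by apply: ereal_inf_lbound; exists n.
  rewrite muleC lee_pdivrMl// -EFinM.
  (* The error [2 * (n * e / 2)] of [tau_n_le] becomes [e] after division by [n]. *)
  have ne : 0 < n%:R * e / 2 by rewrite divr_gt0 ?mulr_gt0.
  have cB := cfun_birkhoff n calpha cphi.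
  apply: le_trans (tau_n_le cX pA smu cB (expR_gt0 (n%:R * (t + mu phi))) ne _) _.
    move=> x; apply: le_trans (Hn x).
    rewrite (iter_Aphi n calpha hA cphi (cfun_cst 1)).
    rewrite le_eqVlt; apply/orP; left; apply/eqP.
    by congr (iter n A _ x); apply/funext => y; rewrite /Defs.one mulr1.
  by rewrite expRK (mu_birkhoff calpha n hmu cphi) lee_fin; lra.
- apply: le_ereal_inf_tmp => _ [n /= n0 <-]; apply: lee_above => t.
  have nR : 0 < n%:R :> R by rewrite ltr0n.
  rewrite muleC lte_pdivrMl// -EFinM => /ereal_inf_ltP[_ [k [g [gD ->]]] Hg].
  apply/lee_addgt0Pr => e e0; rewrite -EFinD.
  (* Passing from [phi] to [phi / n] divides this error by [n], leaving [e]. *)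
  have ne : 0 < n%:R * e by rewrite mulr_gt0.
  have [phi [theta [cphi t0 At lnt]]] := tau_nD_potential cX x0 pA smu gD Hg ne.
  have cpsi : cfun (fun x => n%:R^-1 * phi x) by exact: cfunZ.
  apply: (@le_trans _ _
      (spectral_potential A (fun x => (n%:R^-1 * phi x)%R) -
       (mu (fun x => (n%:R^-1 * phi x)%R))%:E)%E).
    by apply: ereal_inf_lbound; exists (fun x => n%:R^-1 * phi x).
  rewrite leeBlDr// -EFinD.
  apply: le_trans (spectral_mean cX x0 calpha hA cphi n0 t0 At) _.
  rewrite lee_fin (plfZ _ (state_plf smu))// ler_pdivrMr//.
  have -> : (t + e + n%:R^-1 * mu phi) * n%:R = n%:R * t + n%:R * e + mu phi.
    by field; rewrite gt_eqF.
  lra.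
Qed.
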